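(* For every real $p\ge1$ and every positive integer $d$, the optimal Kato constant in two-dimensional domains satisfies $$\kappa(p,2,d)=\min\big(2,\,1+(p-1)^2\big).$$
   Context: Let $n,d$ be positive integers and $p\ge1$. Consider $C^2$ maps $u:\mathbb{R}^n\to\mathbb{R}^d$ with $\nabla u(0)\ne0$ that satisfy the $p$-harmonic map equation $\operatorname{div}(|\nabla u|^{p-2}\nabla u)=0$ at the point $0\in\mathbb{R}^n$, i.e., writing $u_i^a=\partial_iu^a$ and $u_{ij}^a=\partial_i\partial_ju^a$, $$|\nabla u|^2\sum_{i}u_{ii}^a+(p-2)\sum_{i,j,b}u_i^a\,u_j^b\,u_{ij}^b=0\quad\text{at }0,\ \text{for all }a=1,\dots,d.$$ The optimal Kato constant $\kappa(p,n,d)$ is the largest number such that $$\kappa(p,n,d)\,\big|\nabla|\nabla u|(0)\big|^2\le|\nabla^2u(0)|^2$$ for all such maps $u$. Here $|\nabla u|^2=\sum_{i,a}(u_i^a)^2$, $|\nabla^2u|^2=\sum_{i,j,a}(u_{ij}^a)^2$, and $\nabla|\nabla u|$ is the gradient of the scalar function $|\nabla u|$. *)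

(* Defs.v *)
From HB Require Import structures.
From mathcomp Require Import all_boot all_order all_algebra.
From mathcomp Require Import all_classical all_reals all_analysis.
Set Implicit Arguments.
Unset Strict Implicit.
Unset Printing Implicit Defensive.
Import Order.TTheory GRing.Theory Num.Theory.
Import numFieldNormedType.Exports.
Local Open Scope classical_set_scope.
Local Open Scope ring_scope.

Section Kato.
Variable R : realType.

Definition pderiv (n : nat) (i : 'I_n) (f : 'rV[R]_n -> R) : 'rV[R]_n -> R :=
  fun x => 'D_(delta_mx 0 i) f x.

(* [pderiv] is a total operator, with an arbitrary value where the limit does
   not exist, so the existence of the partial derivatives is stated apart. *)
Definition C1 (n : nat) (f : 'rV[R]_n -> R) : Prop :=
  continuous f /\
  forall i : 'I_n,
    (forall x, derivable f x (delta_mx 0 i)) /\ continuous (pderiv i f).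

Definition C2 (n : nat) (f : 'rV[R]_n -> R) : Prop :=
  C1 f /\ forall i : 'I_n, C1 (pderiv i f).

Section Map.
Variables (n d : nat) (u : 'rV[R]_n -> 'rV[R]_d).

Definition component (a : 'I_d) : 'rV[R]_n -> R := fun x => u x 0 a.

Definition C2_map : Prop := forall a : 'I_d, C2 (component a).

Definition u1 (i : 'I_n) (a : 'I_d) : 'rV[R]_n -> R := pderiv i (component a).

Definition u2 (i j : 'I_n) (a : 'I_d) : 'rV[R]_n -> R :=
  pderiv i (pderiv j (component a)).

Definition gradmx (x : 'rV[R]_n) : 'M[R]_(n, d) := \matrix_(i, a) u1 i a x.

(* The Euclidean norm; the library's norm on matrices is the sup norm. *)
Definition grad_norm (x : 'rV[R]_n) : R :=
  Num.sqrt (\sum_(i < n) \sum_(a < d) u1 i a x ^+ 2).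

Definition hess_norm_sq (x : 'rV[R]_n) : R :=
  \sum_(i < n) \sum_(j < n) \sum_(a < d) u2 i j a x ^+ 2.

Definition grad_grad_norm_sq (x : 'rV[R]_n) : R :=
  \sum_(i < n) pderiv i grad_norm x ^+ 2.

Definition p_harmonic_at (p : R) (x : 'rV[R]_n) : Prop :=
  forall a : 'I_d,
    grad_norm x ^+ 2 * \sum_(i < n) u2 i i a x +
    (p - 2) * \sum_(i < n) \sum_(j < n) \sum_(b < d)
                u1 i a x * u1 j b x * u2 i j b x = 0.

End Map.

Definition kato_constants (p : R) (n d : nat) : set R :=
  [set k | forall u : 'rV[R]_n -> 'rV[R]_d,
     C2_map u -> gradmx u 0 != 0 -> p_harmonic_at u p 0 ->
     k * grad_grad_norm_sq u 0 <= hess_norm_sq u 0].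

Definition optimal_kato_constant (p : R) (n d : nat) (kappa : R) : Prop :=
  kato_constants p n d kappa /\ ubound (kato_constants p n d) kappa.

End Kato.

(* Main.v *)
(** At a point where |grad u| = 1, split the Hessian into its trace and its
    trace-free part.  Put V = |grad |grad u||^2 and let s V be the squared norm
    of the derivative of u in the direction grad |grad u|, so 0 <= s <= 1.  The
    equation fixes the trace, whose contribution to |Hess u|^2 is
    (p - 2)^2 s V / 2, and in dimension two Cauchy-Schwarz bounds the
    contribution of the trace-free part below by 2 (1 + (p - 2) s / 2)^2 V.
    The minimum of the sum over s in [0, 1] is attained at s = 0 when p >= 2
    and at s = 1 when p <= 2.  The quadratic maps y + x y and
    x + x^2 / 2 + (1 - p) y^2 / 2 realize these two values. *)
Require Import Defs.
From mathcomp Require Import all_boot all_order all_algebra.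
From mathcomp Require Import all_classical all_reals all_analysis.
From mathcomp Require Import ring lra.
Set Implicit Arguments.
Unset Strict Implicit.
Unset Printing Implicit Defensive.
Import Order.TTheory GRing.Theory Num.Theory.
Import numFieldNormedType.Exports.
Local Open Scope classical_set_scope.
Local Open Scope ring_scope.

(** * Directional derivatives along lines and symmetry of mixed derivatives *)

Section DirectionalDerivative.
Context {R : realType} {V : normedModType R}.
Implicit Types (f : V -> R) (x v e w : V).

(** The two difference quotients coincide, so one-variable results such as the mean value theorem
    and the chain rule apply along a line. *)
Lemma is_derive_line f x v (t : R) :
  derivable f (t *: v + x) v ->
  is_derive t 1 (fun h : R => f (h *: v + x)) ('D_v f (t *: v + x)).
Proof.
have E : (fun h : R => h^-1 *: (((fun h : R => f (h *: v + x)) \o shift t)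
           (h *: 1) - (fun h : R => f (h *: v + x)) t)) =
         (fun h : R => h^-1 *: ((f \o shift (t *: v + x)) (h *: v)
           - f (t *: v + x))).
  by apply/funext => h /=; rewrite [_%:A]mulr1 scalerDl addrA.
by move=> df; apply: DeriveDef; rewrite /derivable /derive E.
Qed.

Lemma MVT_line f x v (h : R) : 0 < h -> (forall y, derivable f y v) ->
  exists2 c, c \in `]0, h[%R & f (h *: v + x) - f x = 'D_v f (c *: v + x) * h.
Proof.
move=> h0 df.
have [||c ch] := @MVT R (fun t => f (t *: v + x))
    (fun t => 'D_v f (t *: v + x)) _ _ h0.
- by move=> t _; exact/is_derive_line.
- apply: derivable_within_continuous => t _.
  by have [] := is_derive_line (df (t *: v + x)).
- by rewrite scale0r add0r subr0 => E; exists c.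
Qed.

(** The mean value theorem is used twice: along [e] for the difference [g] of two translates of [f],
    then along [w] for ['D_e f]. *)
Lemma mixed_increment f x e w (h : R) : 0 < h ->
  (forall y, derivable f y e) -> (forall y, derivable ('D_e f) y w) ->
  exists s t, [/\ s \in `]0, h[%R, t \in `]0, h[%R &
    f (h *: e + (h *: w + x)) - f (h *: e + x) - (f (h *: w + x) - f x) =
    'D_w ('D_e f) (t *: w + (s *: e + x)) * h * h].
Proof.
move=> h0 df ddf.
pose g y := f (h *: w + y) - f y.
have dg y : is_derive y e g ('D_e f (h *: w + y) - 'D_e f y).
  have d1 : is_derive y e (fun y => f (h *: w + y)) ('D_e f (h *: w + y)).
    have E : (fun k : R => k^-1 *: (((fun y => f (h *: w + y)) \o shift y)
               (k *: e) - f (h *: w + y))) =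
             (fun k : R => k^-1 *: ((f \o shift (h *: w + y)) (k *: e)
               - f (h *: w + y))).
      by apply/funext => k /=; rewrite addrCA.
    by apply: DeriveDef; rewrite /derivable /derive E //; exact: df.
  exact: is_deriveB d1 (derivableP (df y)).
have [s sh Es] := @MVT_line g x e h h0
  (fun y => let: DeriveDef d _ := dg y in d).
have [t th Et] := @MVT_line ('D_e f) (s *: e + x) w h h0 ddf.
exists s, t; split => //.
rewrite -Et -(@derive_val _ _ _ _ _ _ _ (dg _)) -Es /g addrCA opprB addrCA.
by ring.
Qed.

(* Both orders of differentiation write the same second increment as [h ^ 2]
   times a mixed derivative at a point within [h] of [x]. *)
Lemma derive_comm f x e w :
  (forall y, derivable f y e) -> (forall y, derivable f y w) ->
  (forall y, derivable ('D_e f) y w) -> (forall y, derivable ('D_w f) y e) ->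
  {for x, continuous ('D_w ('D_e f))} -> {for x, continuous ('D_e ('D_w f))} ->
  'D_w ('D_e f) x = 'D_e ('D_w f) x.
Proof.
move=> de dw dew dwe c1 c2.
apply/eqP; rewrite -subr_eq0 -normr_le0; apply/ler_addgt0Pr => eps eps0.
rewrite add0r.
(* The estimate is uniform in [s] and [t], because the mean value points are known only after [h] is
   chosen. *)
have small (F : V -> R) (a b : V) : {for x, continuous F} ->
    \forall h \near 0^'+, forall s t, s \in `]0, h[%R -> t \in `]0, h[%R ->
      `|F x - F (t *: b + (s *: a + x))| < eps / 2.
  move=> /cvgrPdist_lt /(_ (eps / 2)).
  rewrite divr_gt0// => /(_ isT) nF.
  have cont : (fun st : R * R => st.2 *: b + (st.1 *: a + x)) @ (0, 0) -->
      0 *: b + (0 *: a + x).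
    apply: cvgD; first by apply: cvgZl; exact: cvg_snd.
    by apply: cvgD; [apply: cvgZl; exact: cvg_fst|exact: cvg_cst].
  rewrite !scale0r !add0r in cont.
  have /nbhs_ballP[r /= r0 br] := cont _ nF.
  near=> h => s t /[!in_itv]/= /andP[s0 sh] /andP[t0 th].
  have hr : h < r by near: h; exact: nbhs_right_lt.
  apply: (br (s, t)); split; rewrite /ball/= sub0r normrN gtr0_norm//.
    exact: lt_trans hr.
  exact: lt_trans hr.
have n1 := small _ e w c1; have n2 := small _ w e c2.
have [h [h0 [S1 S2]]] := filter_ex (filterI (nbhs_right_gt (0 : R))
  (filterI n1 n2)).
have [s [t [sh th E1]]] := @mixed_increment f x e w h h0 de dew.
have [t' [s' [th' sh' E2]]] := @mixed_increment f x w e h h0 dw dwe.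
(* Both sides times [h * h] are the same second increment, regrouped. *)
have E : 'D_w ('D_e f) (t *: w + (s *: e + x)) =
         'D_e ('D_w f) (s' *: e + (t' *: w + x)).
  have hN : h != 0 by rewrite gt_eqF.
  apply: (mulIf hN); apply: (mulIf hN).
  have swap (a b c k : R) : a - b - (c - k) = a - c - (b - k) by ring.
  apply: etrans (esym E1) _; apply: etrans E2.
  by rewrite (addrCA (h *: w)); exact: swap.
have close (a b c : R) : `|a - c| < eps / 2 -> `|b - c| < eps / 2 ->
    `|a - b| <= eps.
  move=> ac bc; apply: le_trans (ler_distD c a b) _; rewrite (distrC c b).
  by rewrite [leRHS]splitr; apply/lerD; exact: ltW.
by apply: (close _ _ _ (S1 _ _ sh th)); rewrite E; exact: S2.
Unshelve. all: by end_near. Qed.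

(** Restriction to the line through [x] in direction [v] reduces this to the one-variable chain
    rule. *)
Lemma is_derive_sqrt f x v (df : R) : 0 < f x -> is_derive x v f df ->
  is_derive x v (fun y => Num.sqrt (f y)) ((2 * Num.sqrt (f x))^-1 * df).
Proof.
move=> fx0 [dfx <-].
have E0 : 0 *: v + x = x by rewrite scale0r add0r.
have along (g : V -> R) : derivable g x v ->
    is_derive (0 : R) 1 (fun h : R => g (h *: v + x)) ('D_v g x).
  by have := @is_derive_line g x v 0; rewrite E0.
have sqrt_fx : is_derive (f (0 *: v + x)) 1 Num.sqrt (2 * Num.sqrt (f x))^-1.
  by rewrite E0; exact: is_derive1_sqrt.
have [d1 e1] := is_derive1_comp sqrt_fx (along f dfx).
have d2 : derivable (fun y => Num.sqrt (f y)) x v by apply/derivable1P.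
by apply: DeriveDef => //; have [_ <-] := along _ d2.
Qed.

End DirectionalDerivative.

(** * Symmetry of the Hessian and the gradient of |grad u| *)

Section GradNorm.
Context {R : realType} {n d : nat} (u : 'rV[R]_n -> 'rV[R]_d).
Hypothesis uC2 : C2_map u.

Lemma u2_sym (i j : 'I_n) (a : 'I_d) x : u2 u i j a x = u2 u j i a x.
Proof.
have [[_ d1] d2] := uC2 a.
apply: derive_comm => [y|y|y|y||].
- by have [] := d1 j.
- by have [] := d1 i.
- by have [_ /(_ i)[]] := d2 j.
- by have [_ /(_ j)[]] := d2 i.
- by have [_ /(_ i)[_ c]] := d2 j; exact: c.
- by have [_ /(_ j)[_ c]] := d2 i; exact: c.
Qed.

Lemma grad_norm_sq x :
  grad_norm u x ^+ 2 = \sum_(i < n) \sum_(a < d) u1 u i a x ^+ 2.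
Proof.
rewrite sqr_sqrtr// sumr_ge0// => i _; rewrite sumr_ge0// => a _.
exact: sqr_ge0.
Qed.

Lemma grad_norm_gt0 x : (0 < grad_norm u x) = (gradmx u x != 0).
Proof.
rewrite lt0r sqrtr_ge0 andbT; congr negb; rewrite -sqrf_eq0 grad_norm_sq.
apply/idP/eqP => [|/matrixP A0].
- rewrite psumr_eq0 => [/allP s0|i _]; last first.
    by rewrite sumr_ge0// => a _; exact: sqr_ge0.
  apply/matrixP => i a; rewrite !mxE.
  have := s0 i (mem_index_enum _).
  rewrite psumr_eq0 => [/allP|b _]; last exact: sqr_ge0.
  by move=> /(_ a (mem_index_enum _)); rewrite /= sqrf_eq0 => /eqP.
- rewrite big1// => i _; rewrite big1// => a _.
  by have := A0 i a; rewrite !mxE => ->; rewrite expr0n.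
Qed.

(** Differentiates the square root of |grad u|^2, which is smooth enough only where the gradient is
    nonzero; the factor [grad_norm u x] clears the denominator. *)
Lemma pderiv_grad_norm (k : 'I_n) x : gradmx u x != 0 ->
  grad_norm u x * pderiv k (grad_norm u) x =
  \sum_(i < n) \sum_(a < d) u1 u i a x * u2 u k i a x.
Proof.
rewrite -grad_norm_gt0 => g0.
pose S : 'rV[R]_n -> R := \sum_(i < n) \sum_(a < d) u1 u i a ^+ 2.
have SE y : S y = \sum_(i < n) \sum_(a < d) u1 u i a y ^+ 2.
  by rewrite /S fct_sumE; apply: eq_bigr => i _; rewrite fct_sumE.
have gE : grad_norm u = fun y => Num.sqrt (S y).
  by apply/funext => y; rewrite SE.
have S0 : 0 < S x by rewrite SE -grad_norm_sq exprn_gt0.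
have dS : is_derive x (delta_mx 0 k : 'rV[R]_n) S
    (\sum_(i < n) \sum_(a < d) (2 * u1 u i a x ^+ 1) *: u2 u k i a x).
  apply: is_derive_sum => i; apply: is_derive_sum => a.
  apply: is_deriveX; apply: derivableP.
  by have [_ /(_ i)[_ /(_ k)[]]] := uC2 a.
have [_ dg] := is_derive_sqrt S0 dS.
rewrite /pderiv {2}gE dg.
have -> : Num.sqrt (S x) = grad_norm u x by rewrite gE.
rewrite invfM mulrA mulrCA mulfV ?gt_eqF// mulr1 mulr_sumr.
apply: eq_bigr => i _; rewrite mulr_sumr; apply: eq_bigr => a _.
by rewrite expr1 -[_ *: _]/(_ * _) !mulrA mulVf ?mul1r// pnatr_eq0.
Qed.

End GradNorm.

(** * The pointwise inequality in dimension two *)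

Section KatoInequality.
Context {R : realType}.

(** For [p >= 2], expanding the square leaves 2 plus nonnegative terms. For [p <= 2], the excess
    over the value at [s = 1] factors through [1 - s], and [p >= 1] makes the cofactor
    nonnegative. *)
Lemma kato_profile (p s : R) : 1 <= p -> 0 <= s <= 1 ->
  Num.min 2 (1 + (p - 1) ^+ 2) <=
  2 * (1 + (p - 2) * s / 2) ^+ 2 + (p - 2) ^+ 2 * s / 2.
Proof.
move=> p1 /andP[s0 s1]; rewrite ge_min; apply/orP.
have [p2|/ltW p2] := leP 2 p; [left|right].
- have q0 : 0 <= p - 2 by rewrite subr_ge0.
  have := mulr_ge0 q0 s0; have := sqr_ge0 ((p - 2) * s).
  have := mulr_ge0 (sqr_ge0 (p - 2)) s0; lra.
- rewrite -subr_ge0.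
  have -> : 2 * (1 + (p - 2) * s / 2) ^+ 2 + (p - 2) ^+ 2 * s / 2
      - (1 + (p - 1) ^+ 2) =
      (1 - s) * ((2 - p) * (2 - (2 - p) * (s + 2) / 2)) by field.
  rewrite !mulr_ge0 ?subr_ge0//.
  have : (2 - p) * (s + 2) <= 1 * 3 by rewrite ler_pM//; lra.
  lra.
Qed.

(* With [A], [B] the two rows of the gradient, [X], [Y], [Z] the entries of the
   Hessian and [(v, w) = |grad u| * grad |grad u|].  [M] is half the squared
   norm of the trace-free Hessian, bounded below by Cauchy-Schwarz ([CS],
   optimized over [l]); the trace itself is given by the equation. *)
Lemma kato_inequality (d : nat) (p : R) (A B X Y Z : 'I_d -> R) (N v w : R) :
  1 <= p -> 0 < N -> N = \sum_a (A a ^+ 2 + B a ^+ 2) ->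
  v = \sum_a (A a * X a + B a * Y a) -> w = \sum_a (A a * Y a + B a * Z a) ->
  (forall a, N * (X a + Z a) + (p - 2) * (A a * v + B a * w) = 0) ->
  Num.min 2 (1 + (p - 1) ^+ 2) * (v ^+ 2 + w ^+ 2) <=
  N * \sum_a (X a ^+ 2 + 2 * Y a ^+ 2 + Z a ^+ 2).
Proof.
move=> p1 N0 NE vE wE harm.
have NN0 : N != 0 by rewrite gt_eqF.
set V := v ^+ 2 + w ^+ 2.
(* The ratio [s] below is meaningful only for [V != 0]; otherwise the left-hand side vanishes. *)
have [V0|V0] := eqVneq V 0.
  rewrite V0 mulr0 mulr_ge0 ?(ltW N0)// sumr_ge0// => a _.
  by have := sqr_ge0 (X a); have := sqr_ge0 (Y a); have := sqr_ge0 (Z a); lra.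
have Vgt0 : 0 < V by rewrite lt0r V0 addr_ge0 ?sqr_ge0.
pose W := \sum_a (A a * v + B a * w) ^+ 2.
pose M := \sum_a (((X a - Z a) / 2) ^+ 2 + Y a ^+ 2).
pose P := \sum_a ((X a - Z a) / 2 * (A a * v - B a * w)
                  + Y a * (A a * w + B a * v)).
pose s := W / (N * V).
have WE : W = s * (N * V) by rewrite divfK// mulf_neq0.
have T a : X a + Z a = - ((p - 2) / N * (A a * v + B a * w)).
  apply: (mulfI NN0); rewrite -[LHS]addr0.
  rewrite -[in LHS](subrr ((p - 2) * (A a * v + B a * w))).
  by rewrite addrA harm; field.
have sumE : \sum_a (X a ^+ 2 + 2 * Y a ^+ 2 + Z a ^+ 2) =
    2 * M + (p - 2) ^+ 2 * W / (2 * N ^+ 2).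
  rewrite /M /W !mulr_sumr mulr_suml -big_split; apply: eq_bigr => a _ /=.
  have -> : (p - 2) ^+ 2 * (A a * v + B a * w) ^+ 2 / (2 * N ^+ 2) =
    (X a + Z a) ^+ 2 / 2 by rewrite T; field.
  by field.
(* Pairing the full Hessian with the gradient and [(v, w)] gives [V]. Removing the trace part, known
   from [T], leaves [P]. *)
have PE : P = V * (1 + (p - 2) * s / 2).
  have -> : V * (1 + (p - 2) * s / 2) = v * v + w * w + (p - 2) * W / (2 * N).
    by rewrite WE /V; field.
  rewrite {2}vE {2}wE /W !mulr_sumr mulr_suml -!big_split; apply: eq_bigr => a _ /=.
  have -> : (p - 2) * (A a * v + B a * w) ^+ 2 / (2 * N) =
    - ((X a + Z a) * (A a * v + B a * w) / 2) by rewrite T; field.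
  by field.
(* Completing the square works because [(A v - B w)^2 + (A w + B v)^2 = (A^2 + B^2) V], an identity
   special to dimension two. *)
have CS (l : R) : 2 * l * P - l ^+ 2 * (N * V) <= M.
  rewrite -subr_ge0 NE /M /P !mulr_suml !mulr_sumr -!sumrB sumr_ge0// => a _.
  have -> : ((X a - Z a) / 2) ^+ 2 + Y a ^+ 2
    - (2 * l * ((X a - Z a) / 2 * (A a * v - B a * w) + Y a * (A a * w + B a * v))
       - l ^+ 2 * ((A a ^+ 2 + B a ^+ 2) * V)) =
    ((X a - Z a) / 2 - l * (A a * v - B a * w)) ^+ 2
    + (Y a - l * (A a * w + B a * v)) ^+ 2 by rewrite /V; field.
  by rewrite addr_ge0 ?sqr_ge0.
(* The upper bound is Lagrange's identity, with defect [(A w - B v)^2]. *)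
have s01 : 0 <= s <= 1.
  rewrite divr_ge0 ?mulr_ge0 ?(ltW N0) ?(ltW Vgt0) ?sumr_ge0//=; last first.
    by move=> a _; exact: sqr_ge0.
  rewrite ler_pdivrMr ?mulr_gt0// mul1r -subr_ge0 NE mulr_suml -sumrB.
  rewrite sumr_ge0// => a _.
  have -> : (A a ^+ 2 + B a ^+ 2) * V - (A a * v + B a * w) ^+ 2 =
    (A a * w - B a * v) ^+ 2 by rewrite /V; ring.
  exact: sqr_ge0.
apply: le_trans (_ : (2 * (1 + (p - 2) * s / 2) ^+ 2
  + (p - 2) ^+ 2 * s / 2) * V <= _).
  by rewrite ler_pM2r// kato_profile.
(* This is the maximizing value [l = P / (N * V)]. *)
have := CS ((1 + (p - 2) * s / 2) / N); rewrite PE => /(ler_wpM2l (ltW N0)) H.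
rewrite sumE WE.
set r := 1 + _ in H *.
have H' : V * r ^+ 2 <= N * M.
  by apply: le_trans H; rewrite le_eqVlt; apply/orP; left; apply/eqP; field.
have -> : N * (2 * M + (p - 2) ^+ 2 * (s * (N * V)) / (2 * N ^+ 2)) =
  2 * (N * M) + (p - 2) ^+ 2 * s / 2 * V by field.
lra.
Qed.

End KatoInequality.

(** * Calculus of quadratic test maps *)

Section Quadratic.
Context {R : realType}.

(* Halving [e] and [g] makes the family stable under differentiation, and
   [e], [f], [g] the entries of the Hessian. *)
Definition quad (c a b e f g : R) (x : 'rV[R]_2) : R :=
  c + a * x 0 ord0 + b * x 0 ord_max + e / 2 * x 0 ord0 ^+ 2
  + f * (x 0 ord0 * x 0 ord_max) + g / 2 * x 0 ord_max ^+ 2.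

Lemma is_derive_coord (x v : 'rV[R]_2) (j : 'I_2) :
  is_derive x v (fun y : 'rV[R]_2 => y 0 j) (v 0 j).
Proof.
have dc : derivable (fun y : 'rV[R]_2 => y 0 j) x v.
  exact/diff_derivable/differentiable_coord.
apply: DeriveDef => //.
have := @derive_mx _ _ _ _ (id : 'rV[R]_2 -> 'rV[R]_2) x v (@derivable_id _ _ _ _).
by rewrite derive_id => /(congr1 (fun M : 'rV[R]_2 => M 0 j)); rewrite mxE.
Qed.

Lemma is_derive_quad (c a b e f g : R) (x v : 'rV[R]_2) :
  is_derive x v (quad c a b e f g)
    (v 0 ord0 * quad a e f 0 0 0 x + v 0 ord_max * quad b f g 0 0 0 x).
Proof.
pose X (y : 'rV[R]_2) := y 0 ord0; pose Y (y : 'rV[R]_2) := y 0 ord_max.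
have dX : is_derive x v X (v 0 ord0) by exact: is_derive_coord.
have dY : is_derive x v Y (v 0 ord_max) by exact: is_derive_coord.
have -> : quad c a b e f g = cst c + a \*: X + b \*: Y + (e / 2) \*: (X ^+ 2)
    + f \*: (X * Y) + (g / 2) \*: (Y ^+ 2) by [].
have D := is_deriveD (is_deriveD (is_deriveD (is_deriveD (is_deriveD
  (is_derive_cst c x v) (is_deriveZ a dX)) (is_deriveZ b dY))
  (is_deriveZ (e / 2) (is_deriveX 2 dX))) (is_deriveZ f (is_deriveM dX dY)))
  (is_deriveZ (g / 2) (is_deriveX 2 dY)).
apply: is_derive_eq D _.
by rewrite /quad /X /Y /= expr1 /GRing.scale/=; field.
Qed.

Lemma cvg_quad (c a b e f g : R) (F : set_system 'rV[R]_2) (x : 'rV[R]_2) :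
  Filter F -> F --> x -> quad c a b e f g y @[y --> F] --> quad c a b e f g x.
Proof.
move=> FF Fx.
have coord (j : 'I_2) : y 0 j @[y --> F] --> x 0 j.
  have c0 := @coord_continuous R 1 2 0 j x.
  by move=> A /c0 /Fx.
have [cX cY] := (coord ord0, coord ord_max).
have cst (k : R) : k @[_ --> F] --> k by exact: cvg_cst.
apply: cvgD; last exact: cvgM (cst _) (cvgM cY cY).
apply: cvgD; last exact: cvgM (cst _) (cvgM cX cY).
apply: cvgD; last exact: cvgM (cst _) (cvgM cX cX).
apply: cvgD; last exact: cvgM (cst _) cY.
by apply: cvgD; [exact: cst|exact: cvgM (cst _) cX].
Qed.

Lemma continuous_quad (c a b e f g : R) : continuous (quad c a b e f g).
Proof. by move=> x; exact: (@cvg_quad _ _ _ _ _ _ (nbhs x)). Qed.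

Lemma pderiv0_quad (c a b e f g : R) :
  pderiv ord0 (quad c a b e f g) = quad a e f 0 0 0.
Proof.
apply/funext => x; rewrite /pderiv.
have [_ ->] := is_derive_quad c a b e f g x (delta_mx 0 ord0).
by rewrite !mxE /= mul1r mul0r addr0.
Qed.

Lemma pderiv1_quad (c a b e f g : R) :
  pderiv ord_max (quad c a b e f g) = quad b f g 0 0 0.
Proof.
apply/funext => x; rewrite /pderiv.
have [_ ->] := is_derive_quad c a b e f g x (delta_mx 0 ord_max).
by rewrite !mxE /= mul1r mul0r add0r.
Qed.

Lemma ord2_cases (i : 'I_2) : i = ord0 \/ i = ord_max.
Proof. by case: i => [[|[|//]] ?]; [left|right]; apply/val_inj. Qed.

Lemma C1_quad (c a b e f g : R) : C1 (quad c a b e f g).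
Proof.
split=> [|i]; first exact: continuous_quad.
split=> [x|]; first by have [] := is_derive_quad c a b e f g x (delta_mx 0 i).
by have [->|->] := ord2_cases i; rewrite ?pderiv0_quad ?pderiv1_quad;
  exact: continuous_quad.
Qed.

Lemma C2_quad (c a b e f g : R) : C2 (quad c a b e f g).
Proof.
split=> [|i]; first exact: C1_quad.
by have [->|->] := ord2_cases i; rewrite ?pderiv0_quad ?pderiv1_quad; exact: C1_quad.
Qed.

Lemma quad_at0 (c a b e f g : R) : quad c a b e f g 0 = c.
Proof. by rewrite /quad !mxE expr0n /= !mulr0 !addr0. Qed.

(** A scalar quadratic placed in the first component, so that the same examples serve every positive
    target dimension. *)
Definition quad_map d (a b e f g : R) (x : 'rV[R]_2) : 'rV[R]_d.+1 :=
  quad 0 a b e f g x *: delta_mx 0 ord0.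

Section QuadMap.
Variables (d : nat) (a b e f g : R).
Let u := @quad_map d a b e f g.
Let m (j : 'I_d.+1) : R := (j == ord0)%:R.

Lemma component_quad_map j :
  component u j = quad 0 (a * m j) (b * m j) (e * m j) (f * m j) (g * m j).
Proof.
by apply/funext => x; rewrite /component /u /quad_map /quad !mxE /= /m; ring.
Qed.

Lemma C2_quad_map : C2_map u.
Proof. by move=> j; rewrite component_quad_map; exact: C2_quad. Qed.

Lemma u1_quad_map j : (u1 u ord0 j 0 = a * m j) * (u1 u ord_max j 0 = b * m j).
Proof.
by rewrite /u1 component_quad_map pderiv0_quad pderiv1_quad !quad_at0.
Qed.

Lemma u2_quad_map j :
  (u2 u ord0 ord0 j 0 = e * m j) * (u2 u ord0 ord_max j 0 = f * m j) *
  (u2 u ord_max ord0 j 0 = f * m j) * (u2 u ord_max ord_max j 0 = g * m j).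
Proof.
by rewrite /u2 component_quad_map !(pderiv0_quad, pderiv1_quad) !quad_at0.
Qed.

End QuadMap.
End Quadratic.

(** * Sums over two indices, test of a constant on quadratics, and conclusion *)

Lemma big_ord2 {R : nmodType} (F : 'I_2 -> R) : \sum_i F i = F ord0 + F ord_max.
Proof.
by rewrite !big_ord_recl big_ord0 addr0; congr (_ + F _); apply/val_inj.
Qed.

Lemma contraction_ord2 {R : comPzRingType} d (x : 'I_2 -> R)
    (F : 'I_2 -> 'I_d -> R) (H : 'I_2 -> 'I_2 -> 'I_d -> R) :
  \sum_i \sum_j \sum_b x i * F j b * H i j b =
  x ord0 * (\sum_b F ord0 b * H ord0 ord0 b
            + \sum_b F ord_max b * H ord0 ord_max b) +
  x ord_max * (\sum_b F ord0 b * H ord_max ord0 b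
               + \sum_b F ord_max b * H ord_max ord_max b).
Proof.
have E i j : \sum_b x i * F j b * H i j b = x i * \sum_b F j b * H i j b.
  by rewrite mulr_sumr; apply: eq_bigr => b _; rewrite mulrA.
by rewrite !big_ord2 !E !mulrDr.
Qed.

(* Stated for arbitrary arrays rather than for the derivatives of a map, which
   [rewrite] and [ring] would unfold to limits when comparing them. *)
Lemma kato_inequality_ord2 {R : realType} d (p N : R) (v : 'I_2 -> R)
    (F : 'I_2 -> 'I_d -> R) (H : 'I_2 -> 'I_2 -> 'I_d -> R) :
  1 <= p -> 0 < N -> N = \sum_i \sum_b F i b ^+ 2 ->
  (forall i, v i = \sum_j \sum_b F j b * H i j b) ->
  (forall i j b, H i j b = H j i b) ->
  (forall a, N * \sum_i H i i a +
     (p - 2) * \sum_i \sum_j \sum_b F i a * F j b * H i j b = 0) ->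
  Num.min 2 (1 + (p - 1) ^+ 2) * \sum_i v i ^+ 2 <=
  N * \sum_i \sum_j \sum_b H i j b ^+ 2.
Proof.
move=> p1 N0 NE vE symH harm.
have -> : \sum_i \sum_j \sum_b H i j b ^+ 2 = \sum_b (H ord0 ord0 b ^+ 2
    + 2 * H ord0 ord_max b ^+ 2 + H ord_max ord_max b ^+ 2).
  rewrite !big_ord2 -!big_split; apply: eq_bigr => b _ /=.
  by rewrite (symH ord_max ord0); ring.
rewrite big_ord2; apply: (@kato_inequality R d p (F ord0) (F ord_max)) => //.
- by rewrite NE big_ord2 -big_split.
- by rewrite vE big_ord2 -big_split.
- rewrite vE big_ord2 -big_split; apply: eq_bigr => b _ /=.
  by rewrite (symH ord_max ord0).
- by move=> a; rewrite -(harm a) contraction_ord2 !vE !big_ord2; ring.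
Qed.

Lemma sum_masked {R : comPzRingType} d (F G : 'I_d.+1 -> R) (x y : R) :
  (forall j, F j = x * (j == ord0)%:R) ->
  (forall j, G j = y * (j == ord0)%:R) -> \sum_j F j * G j = x * y.
Proof.
move=> FE GE; rewrite (bigD1 ord0)//= big1 => [|j /negPf j0].
  by rewrite FE GE eqxx !mulr1 addr0.
by rewrite FE j0 mulr0 mul0r.
Qed.

Lemma sum_masked_sq {R : comPzRingType} d (F : 'I_d.+1 -> R) (x : R) :
  (forall j, F j = x * (j == ord0)%:R) -> \sum_j F j ^+ 2 = x ^+ 2.
Proof.
move=> FE; rewrite expr2 -(sum_masked FE FE).
by apply: eq_bigr => j _; rewrite expr2.
Qed.

(** Evaluates the Kato inequality at 0 on [quad_map]. The gradient there has norm 1, so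
    [a * e + b * f] and [a * f + b * g] are the entries of grad |grad u|, and the second hypothesis
    is the equation. *)
Lemma kato_constant_quad {R : realType} d (p a b e f g k : R) :
  a ^+ 2 + b ^+ 2 = 1 ->
  e + g + (p - 2) * (a * (a * e + b * f) + b * (a * f + b * g)) = 0 ->
  kato_constants p 2 d.+1 k ->
  k * ((a * e + b * f) ^+ 2 + (a * f + b * g) ^+ 2) <=
  e ^+ 2 + 2 * f ^+ 2 + g ^+ 2.
Proof.
move=> ab1 harm Kk; pose u := @quad_map R d a b e f g.
have A0 j : u1 u ord0 j 0 = a * (j == ord0)%:R by rewrite u1_quad_map.
have A1 j : u1 u ord_max j 0 = b * (j == ord0)%:R by rewrite u1_quad_map.
have H00 j : u2 u ord0 ord0 j 0 = e * (j == ord0)%:R by rewrite u2_quad_map.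
have H01 j : u2 u ord0 ord_max j 0 = f * (j == ord0)%:R by rewrite u2_quad_map.
have H10 j : u2 u ord_max ord0 j 0 = f * (j == ord0)%:R by rewrite u2_quad_map.
have H11 j : u2 u ord_max ord_max j 0 = g * (j == ord0)%:R by rewrite u2_quad_map.
have N2 : grad_norm u 0 ^+ 2 = 1.
  rewrite grad_norm_sq big_ord2 -ab1.
  by congr (_ + _); [exact: sum_masked_sq A0|exact: sum_masked_sq A1].
have N1 : grad_norm u 0 = 1.
  by apply/eqP; rewrite -sqrp_eq1 ?N2// sqrtr_ge0.
have grad_n0 : gradmx u 0 != 0 by rewrite -grad_norm_gt0 N1.
have D i := pderiv_grad_norm (@C2_quad_map R d a b e f g) i grad_n0.
have D0 : pderiv ord0 (grad_norm u) 0 = a * e + b * f.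
  rewrite -[LHS]mul1r -N1 D big_ord2.
  by congr (_ + _); [exact: sum_masked A0 H00|exact: sum_masked A1 H01].
have D1 : pderiv ord_max (grad_norm u) 0 = a * f + b * g.
  rewrite -[LHS]mul1r -N1 D big_ord2.
  by congr (_ + _); [exact: sum_masked A0 H10|exact: sum_masked A1 H11].
have harm_u : p_harmonic_at u p 0.
  move=> j.
  transitivity (1 * (u2 u ord0 ord0 j 0 + u2 u ord_max ord_max j 0) + (p - 2) *
    (u1 u ord0 j 0 * (a * e + b * f) + u1 u ord_max j 0 * (a * f + b * g))).
    congr (_ * _ + _ * _); [exact: N2|exact: big_ord2|].
    apply: etrans (contraction_ord2 _ (fun i b => u1 u i b 0)
      (fun i i' b => u2 u i i' b 0)) _.
    congr (_ * (_ + _) + _ * (_ + _)).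
    - exact: sum_masked A0 H00.
    - exact: sum_masked A1 H01.
    - exact: sum_masked A0 H10.
    - exact: sum_masked A1 H11.
  rewrite (A0 j) (A1 j) (H00 j) (H11 j).
  (* Every term carries the mask [m], so the equation is [harm] times [m]. *)
  move: (_%:R) => m.
  by rewrite -[RHS](mulr0 m) -harm; ring.
have := Kk u (@C2_quad_map R d a b e f g) grad_n0 harm_u.
have -> : grad_grad_norm_sq u 0 = (a * e + b * f) ^+ 2 + (a * f + b * g) ^+ 2.
  by rewrite /grad_grad_norm_sq big_ord2 D0 D1.
have -> : hess_norm_sq u 0 = e ^+ 2 + 2 * f ^+ 2 + g ^+ 2.
  transitivity (e ^+ 2 + f ^+ 2 + (f ^+ 2 + g ^+ 2)); last by ring.
  rewrite /hess_norm_sq big_ord2; congr (_ + _); apply: etrans (big_ord2 _) _.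
  - by congr (_ + _); [exact: sum_masked_sq H00|exact: sum_masked_sq H01].
  - by congr (_ + _); [exact: sum_masked_sq H10|exact: sum_masked_sq H11].
by [].
Qed.

Theorem lemma6p7 (R : realType) (p : R) (d : nat) (hp : 1 <= p) (hd : (0 < d)%N) :
  optimal_kato_constant p 2 d (Num.min 2 (1 + (p - 1) ^+ 2)).
Proof.
split.
- move=> u uC2 A0 harm.
  have g0 : 0 < grad_norm u 0 by rewrite grad_norm_gt0.
  have := kato_inequality_ord2 hp (exprn_gt0 2 g0) (grad_norm_sq u 0)
    (fun i => pderiv_grad_norm uC2 i A0) (fun i j b => u2_sym uC2 i j b 0) harm.
  (* Each entry is |grad u| times a derivative of |grad u|, so |grad u|^2 factors out of both sides
     and cancels. *)
  under eq_bigr do rewrite exprMn.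
  by rewrite -mulr_sumr mulrCA ler_pM2l ?exprn_gt0.
- move=> k; case: d hd => // d _ Kk.
  (* In [K1], grad |grad u| is parallel to the gradient ([s = 1]); in [K2] it is orthogonal
     ([s = 0]). Both have unit length. *)
  have K1 := @kato_constant_quad R d p 1 0 1 0 (1 - p) k _ _ Kk.
  have K2 := @kato_constant_quad R d p 0 1 0 1 0 k _ _ Kk.
  rewrite le_min; apply/andP; split.
  + have := K2 ltac:(ring) ltac:(ring); lra.
  + have := K1 ltac:(ring) ltac:(ring); lra.
Qed.
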